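(* Let $H = I_7 \vee C_5$, where $I_7$ is an independent set on $7$ vertices and $C_5$ is a $5$-cycle. For every positive integer $n$, let $H^{2n}$ be the $2n$-blow-up of $H$. Then $$D_{2,\infty}^b(H^{2n}) = \frac{37}{24^2}\,|H^{2n}|^2 > \frac{|H^{2n}|^2}{16}.$$
   Context: All graphs are simple. For a vertex subset $A$ of a graph $G$, $e(A)$ denotes the number of edges of $G$ with both endpoints in $A$, and $A^c = V(G)\setminus A$. A balanced $2$-partition of a graph $G$ on an even number of vertices is a partition $V(G) = A \cup A^c$ with $|A| = |A^c|$. Define $D_{2,\infty}^b(G) = \min_A \max\{e(A), e(A^c)\}$, the minimum over all balanced $2$-partitions. The join $G_1 \vee G_2$ of two vertex-disjoint graphs has vertex set $V(G_1)\cup V(G_2)$ and edge set $E(G_1)\cup E(G_2)\cup\{v_1v_2 : v_1\in V(G_1), v_2 \in V(G_2)\}$. The $k$-blow-up $G^k$ of $G$ is obtained by replacing each vertex $v$ by $k$ vertices (copies of $v$), where a copy of $u$ is adjacent to a copy of $v$ iff $uv \in E(G)$. $|G|$ denotes the number of vertices. *)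

(* Defs.v *)
From mathcomp Require Import all_boot.

Set Implicit Arguments.
Unset Strict Implicit.
Unset Printing Implicit Defensive.

Record sgraph := SGraph {
  vertex :> finType;
  adj : rel vertex;
  adj_sym : symmetric adj;
  adj_irrefl : irreflexive adj }.

Definition edges (G : sgraph) : {set {set G}} :=
  [set [set p.1; p.2] | p : G * G & adj p.1 p.2].

Definition num_edges_in (G : sgraph) (A : {set G}) : nat :=
  #|[set E in edges G | E \subset A]|.

Definition balanced (G : sgraph) (A : {set G}) : bool := #|A| == #|~: A|.

Definition max_part_edges (G : sgraph) (A : {set G}) : nat :=
  maxn (num_edges_in A) (num_edges_in (~: A)).

(* The default value #|edges G| bounds every max_part_edges A, so it does not
   affect the minimum when a balanced set exists, i.e. when #|G| is even
   (see min_balanced_attained and min_balanced_le); for #|G| odd the value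
   is a dummy. *)
Definition min_balanced (G : sgraph) : nat :=
  \big[minn/#|edges G|]_(A : {set G} | balanced A) max_part_edges A.

Section Edgeless.
Variable m : nat.
Definition edgeless_adj : rel 'I_m := fun _ _ => false.
Lemma edgeless_sym : symmetric edgeless_adj. Proof. by []. Qed.
Lemma edgeless_irrefl : irreflexive edgeless_adj. Proof. by []. Qed.
Definition edgeless : sgraph := SGraph edgeless_sym edgeless_irrefl.
End Edgeless.

(* The m-cycle for m >= 3; the conjunct i != j matters only for m = 1. *)
Section Cycle.
Variable m : nat.
Definition cycle_adj : rel 'I_m :=
  fun i j => (i != j) && ((j == i.+1 %% m :> nat) || (i == j.+1 %% m :> nat)).
Lemma cycle_sym : symmetric cycle_adj.
Proof. by move=> i j; rewrite /cycle_adj eq_sym orbC. Qed.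
Lemma cycle_irrefl : irreflexive cycle_adj.
Proof. by move=> i; rewrite /cycle_adj eqxx. Qed.
Definition cycle_graph : sgraph := SGraph cycle_sym cycle_irrefl.
End Cycle.

Section Join.
Variables G1 G2 : sgraph.
Definition join_adj : rel (G1 + G2)%type := fun x y =>
  match x, y with
  | inl u, inl v => adj u v
  | inr u, inr v => adj u v
  | _, _ => true
  end.
Lemma join_sym : symmetric join_adj.
Proof. by case=> u [] v //=; apply: adj_sym. Qed.
Lemma join_irrefl : irreflexive join_adj.
Proof. by case=> u /=; apply: adj_irrefl. Qed.
Definition join : sgraph := SGraph join_sym join_irrefl.
End Join.

(* The vertex (v, i) is the i-th copy of v. *)
Section Blowup.
Variables (G : sgraph) (k : nat).
Definition blowup_adj : rel (G * 'I_k)%type := fun x y => adj x.1 y.1.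
Lemma blowup_sym : symmetric blowup_adj.
Proof. by move=> x y; apply: adj_sym. Qed.
Lemma blowup_irrefl : irreflexive blowup_adj.
Proof. by move=> x; apply: adj_irrefl. Qed.
Definition blowup : sgraph := SGraph blowup_sym blowup_irrefl.
End Blowup.

Lemma max_part_edges_le (G : sgraph) (A : {set G}) :
  max_part_edges A <= #|edges G|.
Proof.
by rewrite geq_max; apply/andP; split;
  apply/subset_leq_card/subsetP=> E; rewrite inE => /andP[].
Qed.

Lemma min_balanced_le (G : sgraph) (A : {set G}) :
  balanced A -> min_balanced G <= max_part_edges A.
Proof.
move=> bA; rewrite /min_balanced.
elim: (index_enum _) (mem_index_enum A) => //= B r IHr.
rewrite inE big_cons; case: eqVneq => [<- _|_ /= /IHr leA].
  by rewrite bA geq_minl.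
by case: ifP => // _; rewrite geq_min leA orbT.
Qed.

Lemma exists_balanced (G : sgraph) :
  ~~ odd #|G| -> exists A : {set G}, balanced A.
Proof.
move=> evG; have le_half : #|G|./2 <= #|G|.
  by rewrite -{2}(odd_double_half #|G|) -addnn addnA leq_addl.
exists [set x in take #|G|./2 (enum G)].
have cA : #|[set x in take #|G|./2 (enum G)]| = #|G|./2.
  rewrite cardsE (card_uniqP _) ?take_uniq ?enum_uniq //.
  by rewrite size_takel // -cardE.
rewrite /balanced -(eqn_add2l #|[set x in take #|G|./2 (enum G)]|) cardsC cA.
by rewrite addnn even_halfK.
Qed.

Lemma min_balanced_attained (G : sgraph) : ~~ odd #|G| ->
  exists2 A : {set G}, balanced A & min_balanced G = max_part_edges A.
Proof.
move=> /exists_balanced[A0 bA0].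
case: (@arg_minnP _ A0 (@balanced G) (@max_part_edges G) bA0) => A bA leA.
exists A => //; apply/eqP; rewrite eqn_leq min_balanced_le //= /min_balanced.
elim/big_rec: _ => [|B m bB le_m]; first exact: max_part_edges_le.
by rewrite leq_min leA.
Qed.

(* Main.v *)
(* Write c v for the number of copies of v in A, let x and s be the numbers of
   vertices of A in the blow-ups of I_7 and C_5, and let Q be the cyclic sum of
   c_i * c_(i+1) over C_5; put k = 2n.  A balanced A has x + s = 6k and
   e(A) = x * s + Q.  Replacing A by its complement turns s into 5k - s, so we
   may assume s >= 5n, and e(A) >= 37 n^2 then follows from Q >= k (s - 2k) when
   s <= 9n, and from Q >= 2ks - 5k^2 (the cyclic sum for the complement being
   nonnegative) when s >= 9n.  Equality holds for c = n on I_7 and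
   c = (2n, 0, 2n, n, 0) on C_5. *)
Require Import Defs.
From mathcomp Require Import all_boot all_order all_algebra.
From mathcomp Require Import zify ring lra.
Import Order.TTheory GRing.Theory Num.Theory.
Local Open Scope ring_scope.

Section EdgeCount.
Local Open Scope nat_scope.

(** The adjacent ordered pairs in [A] are partitioned by their endpoint sets. The fibre over an edge
    is {(u, v), (v, u)}, which has two elements because [adj] is irreflexive. *)
Lemma double_num_edges_in (G : sgraph) (A : {set G}) :
  2 * num_edges_in A = \sum_(u in A) \sum_(v in A) adj u v.
Proof.
pose P := [set p : G * G | [&& p.1 \in A, p.2 \in A & adj p.1 p.2]].
pose ends (p : G * G) := [set p.1; p.2].
have -> : \sum_(u in A) \sum_(v in A) adj u v = \sum_(p in P) 1.
  rewrite pair_big_dep /= [LHS](bigID (fun p => adj p.1 p.2)) /=.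
  rewrite [X in _ + X]big1 ?addn0; last by move=> p /andP[_ /negbTE->].
  apply: eq_big => [p|p /andP[_ ->] //]; by rewrite inE andbA.
have -> : num_edges_in A = #|ends @: P|.
  apply: eq_card => E; rewrite inE; apply/andP/imsetP.
    case=> /imsetP[p]; rewrite inE => pq -> /subsetP sA.
    by exists p => //; rewrite inE pq !sA ?set21 ?set22.
  case=> p; rewrite inE => /and3P[pA qA pq] ->; split.
    by apply/imsetP; exists p; rewrite ?inE.
  by apply/subsetP=> z /set2P[->|->].
rewrite (partition_big_imset ends) /= mulnC -sum_nat_const.
apply: eq_bigr => E /imsetP[[u v]]; rewrite inE /= => /and3P[uA vA uv] ->.
have uDv : u != v by apply: contraTneq uv => ->; rewrite adj_irrefl.
rewrite sum1_card -[LHS](_ : #|[set (u, v); (v, u)]| = 2); last first.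
  by rewrite cards2 xpair_eqE negb_and uDv.
apply: eq_card => -[w z]; rewrite !inE !xpair_eqE unfold_in /= inE /=.
apply/idP/idP.
  case/orP=> /andP[/eqP-> /eqP->]; first by rewrite uA vA uv eqxx.
  by rewrite uA vA adj_sym uv /ends /= setUC eqxx.
case/andP=> /and3P[_ _ wz] /eqP eqE.
have : w \in ends (u, v) by rewrite -eqE set21.
have : z \in ends (u, v) by rewrite -eqE set22.
by case/set2P=> /= e1 /set2P[] /= e2; move: wz;
  rewrite e1 e2 ?adj_irrefl ?eqxx ?orbT.
Qed.

End EdgeCount.

Section BlowupCount.
Local Open Scope nat_scope.
Variables (G : sgraph) (k : nat).
Implicit Types (A : {set blowup G k}) (v : G).

Definition copies A v : nat := #|[set i : 'I_k | (v, i) \in A]|.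

Lemma sum_blowup A (F : G -> nat) :
  \sum_(p in A) F p.1 = \sum_v copies A v * F v.
Proof.
rewrite [LHS](eq_bigl (fun p => true && ((p.1, p.2) \in A))); last by case.
rewrite -(pair_big_dep xpredT (fun v i => (v, i) \in A) (fun v _ => F v)) /=.
apply: eq_bigr => v _; rewrite sum_nat_const; congr (_ * _).
by apply: eq_card => i; rewrite inE.
Qed.

Lemma card_blowup_set A : #|A| = \sum_v copies A v.
Proof.
rewrite -sum1_card (sum_blowup A (fun=> 1)).
by apply: eq_bigr => v _; rewrite muln1.
Qed.

Lemma double_num_edges_in_blowup A :
  2 * num_edges_in A =
  \sum_u copies A u * \sum_v copies A v * adj u v.
Proof.
rewrite double_num_edges_in -sum_blowup.
by apply: eq_bigr => p _; rewrite -sum_blowup.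
Qed.

Lemma copiesC A v : copies (~: A) v = k - copies A v.
Proof.
have <- : #|~: [set i : 'I_k | (v, i) \in A]| = copies (~: A) v.
  by apply: eq_card => i; rewrite !inE.
by rewrite -[X in X - _](card_ord k) -(cardsC [set i | (v, i) \in A]) addKn.
Qed.

Lemma copies_le A v : copies A v <= k.
Proof. by rewrite -[k in _ <= k]card_ord max_card. Qed.

(** Serves to realize prescribed copy counts: the first [t v] of the [k] copies of each vertex are
    selected. *)
Lemma copies_initial (t : G -> nat) v : t v <= k ->
  copies [set p : blowup G k | p.2 < t p.1] v = t v.
Proof.
move=> tk; have inj_w : injective (widen_ord tk).
  by move=> i j /(congr1 val) eq_ij; apply: val_inj.
rewrite -[RHS]card_ord -(card_imset _ inj_w).
apply: eq_card => i; rewrite !inE; apply/idP/imsetP => [it|[j _ ->]].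
  by exists (Ordinal it) => //; apply: val_inj.
exact: (valP j).
Qed.

End BlowupCount.

Arguments copies {G k} A v.

Section CyclicSum.
Local Open Scope nat_scope.
Variables (k a b c d e : nat).
Hypotheses (ak : a <= k) (bk : b <= k) (ck : c <= k) (dk : d <= k) (ek : e <= k).

Let Q := a * b + b * c + c * d + d * e + e * a.
Let s := a + b + c + d + e.

(* [Q - k s + 2 k^2] is affine in [a], and at [a = 0] and [a = k] it equals
   [(k-b)(k-c) + cd + (k-d)(k-e)] and [(k-c)(k-d) + bc + de]. *)
Lemma cyclic_sum_ge_linear : k * s <= Q + 2 * k * k.
Proof. rewrite /Q /s; have [be|be] := leqP k (b + e); nia. Qed.

(** The right side minus the left is (k-a)(k-b) + (k-b)(k-c) + ... + (k-e)(k-a). *)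
Lemma cyclic_sum_ge_compl : 2 * k * s <= Q + 5 * k * k.
Proof. rewrite /Q /s; nia. Qed.

End CyclicSum.

Section JoinCount.
Local Open Scope nat_scope.

Let H := join (edgeless 7) (cycle_graph 5).
Let C (i : nat) : H := inr (inord i : 'I_5).
Let cycle_part {k} (A : {set blowup H k}) : nat :=
  let c := copies A in c (C 0) + c (C 1) + c (C 2) + c (C 3) + c (C 4).

Lemma sum_join (F : H -> nat) :
  \sum_v F v = \sum_(i < 7) F (inl i) +
    (F (C 0) + F (C 1) + F (C 2) + F (C 3) + F (C 4)).
Proof.
rewrite big_sumType /=; congr (_ + _).
have e i (ltin : i < 5) : inr (Ordinal ltin) = C i :> H.
  by congr inr; apply: val_inj; rewrite /= inordK.
rewrite !big_ord_recl big_ord0 addn0 !addnA.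
by do !congr (_ + _); rewrite -?e //; congr (F (inr _)); apply: val_inj.
Qed.

(** Summing degrees within [A]: over I_7 each is [s]; over C_5 each is the I_7 count plus the counts
    at two cyclic neighbours. Every product then occurs twice. *)
Lemma num_edges_in_blowup_join k (A : {set blowup H k}) :
  let c := copies A in
  num_edges_in A =
    (\sum_(i < 7) c (inl i)) * cycle_part A
    + (c (C 0) * c (C 1) + c (C 1) * c (C 2) + c (C 2) * c (C 3)
       + c (C 3) * c (C 4) + c (C 4) * c (C 0)).
Proof.
move=> c; rewrite /cycle_part -/c.
set s := c (C 0) + c (C 1) + c (C 2) + c (C 3) + c (C 4).
have deg_inl i : \sum_v c v * adj (inl i : H) v = s.
  rewrite sum_join big1 => [|j _]; last by rewrite muln0.
  by rewrite add0n !muln1.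
(* Cycle adjacency is restated on natural indices, so that it computes for each numeral [i]. *)
have deg_inr (i : nat) : i < 5 -> \sum_v c v * adj (C i) v =
    \sum_(j < 7) c (inl j) + \sum_(j < 5) c (C j) *
      ((i != j) && ((j == i.+1 %% 5 :> nat) || (i == j.+1 %% 5 :> nat))).
  move=> i5; rewrite sum_join !big_ord_recl !big_ord0 /= /cycle_adj.
  by rewrite -!val_eqE /= !inordK // !muln1 !addn0 !addnA.
apply/eqP; rewrite -(eqn_pmul2l (isT : 0 < 2)) double_num_edges_in_blowup.
rewrite -/c sum_join (eq_bigr (fun i => c (inl i) * s)) => [|i _]; last first.
  by rewrite deg_inl.
rewrite -big_distrl !deg_inr //= !big_ord_recl !big_ord0 /=.
apply/eqP; rewrite /s; ring.
Qed.

Lemma card_blowup_join k : #|blowup H k| = 12 * k.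
Proof. by rewrite card_prod card_sum !card_ord. Qed.

Lemma balanced_blowup_join n (A : {set blowup H (2 * n)}) :
  balanced A = (#|A| == 12 * n).
Proof. have := cardsC A; rewrite card_blowup_join /balanced; lia. Qed.

Lemma num_edges_in_ge n (A : {set blowup H (2 * n)}) :
  balanced A -> 5 * n <= cycle_part A -> 37 * n ^ 2 <= num_edges_in A.
Proof.
rewrite balanced_blowup_join card_blowup_set sum_join num_edges_in_blowup_join.
rewrite -/(cycle_part A) => /eqP bal s_ge.
have le i := copies_le _ _ A (C i).
have := cyclic_sum_ge_linear _ _ _ _ _ _ (le 0) (le 1) (le 2) (le 3) (le 4).
have := cyclic_sum_ge_compl _ _ _ _ _ _ (le 0) (le 1) (le 2) (le 3) (le 4).
rewrite -/(cycle_part A).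
have : cycle_part A <= 10 * n.
  by move: (le 0) (le 1) (le 2) (le 3) (le 4); rewrite /cycle_part; lia.
move: (cycle_part A) (\sum_(i < 7) _) (_ + _ * copies A (C 0)) bal s_ge.
move=> s x Q bal s_ge s_le10 Q_ge2 Q_ge1; have -> : x = 12 * n - s by lia.
(* For s <= 9n, the first bound gives e(A) - 37n^2 >= (s - 5n)(9n - s) >= 0. Beyond, the second
   gives e(A) >= 16ns - s^2 - 20n^2, concave in s, with values 43n^2 at 9n and 40n^2 at 10n. *)
by have [s_le|s_gt] := leqP s (9 * n); nia.
Qed.

Lemma max_part_edges_ge n (A : {set blowup H (2 * n)}) :
  balanced A -> 37 * n ^ 2 <= max_part_edges A.
Proof.
move=> bal; rewrite leq_max; have [s_ge|s_lt] := leqP (5 * n) (cycle_part A).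
  by rewrite num_edges_in_ge.
apply/orP; right; apply: num_edges_in_ge.
  by rewrite /balanced setCK eq_sym; apply: bal.
by move: s_lt; rewrite /cycle_part !copiesC; lia.
Qed.

Lemma exists_optimal_balanced n :
  exists2 A : {set blowup H (2 * n)}, balanced A &
    max_part_edges A = 37 * n ^ 2.
Proof.
pose t (v : H) := match v with
  | inl _ => n
  | inr j => nth 0 [:: 2 * n; 0; 2 * n; n; 0] j
  end.
pose A := [set p : blowup H (2 * n) | p.2 < t p.1].
have copA v : copies A v = t v.
  apply: copies_initial; case: v => [i|[]] /=; first by lia.
  by do 5?case=> //=; lia.
have tC i : i < 5 -> t (C i) = nth 0 [:: 2 * n; 0; 2 * n; n; 0] i.
  by move=> i5; rewrite /= inordK.
exists A.
  rewrite balanced_blowup_join card_blowup_set sum_join !copA !tC //=.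
  under eq_bigr do rewrite copA.
  by rewrite sum_nat_const card_ord; lia.
rewrite /max_part_edges !num_edges_in_blowup_join /cycle_part !copiesC !copA.
under eq_bigr do rewrite copA.
under [in X in maxn _ X]eq_bigr do rewrite copiesC copA.
(* Both halves have 7n vertices over I_7, 5n over C_5 and cyclic sum 2n^2, hence 35n^2 + 2n^2 edges
   each. *)
rewrite !tC //= !sum_nat_const card_ord -[RHS]maxnn; congr maxn; nia.
Qed.

Lemma min_balanced_blowup_join n :
  min_balanced (blowup H (2 * n)) = 37 * n ^ 2.
Proof.
have [A bal eA] := exists_optimal_balanced n.
apply/eqP; rewrite eqn_leq -{1}eA min_balanced_le //=.
have [|B balB ->] := @min_balanced_attained (blowup H (2 * n)).
  by rewrite card_blowup_join; lia.
exact: max_part_edges_ge.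
Qed.

End JoinCount.

Theorem theorem1p6 (n : nat) (n_gt0 : (0 < n)%N) :
  let H := join (edgeless 7) (cycle_graph 5) in
  let G := blowup H (2 * n) in
  (min_balanced G)%:R = 37%:R / 24%:R ^+ 2 * #|G|%:R ^+ 2 :> rat /\
  37%:R / 24%:R ^+ 2 * #|G|%:R ^+ 2 > #|G|%:R ^+ 2 / 16%:R :> rat.
Proof.
move=> H G; have n_gt0_rat : 0 < n%:R :> rat by rewrite ltr0n.
(* Since [#|G|] is 24n, the strict inequality amounts to 37n^2 > 36n^2. *)
rewrite min_balanced_blowup_join card_blowup_join !natrM.
split; first by field.
have : 0 < n%:R ^+ 2 :> rat by rewrite exprn_gt0.
lra.
Qed.
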